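(* Let $T$ and $\tilde T$ be two discrete rectangular tori. Then $T$ and $\tilde T$ are isospectral if and only if they are isomorphic as graphs.
   Context: Graphs are finite and undirected, without loops; multiple edges are allowed. For a graph $G$ with vertex set $V(G)$, let $a_{uv}$ be the number of edges between $u$ and $v$. The adjacency matrix is $A(G)=(a_{uv})_{u,v\in V(G)}$, $D(G)$ is the diagonal matrix of valencies $d(v)=\sum_{u}a_{uv}$, and the Laplacian matrix is $L(G)=D(G)-A(G)$. The Laplacian polynomial is $\chi(G,\lambda)=\det(L(G)-\lambda I_n)$ with $n=|V(G)|$. Two graphs $G,H$ are isospectral if $\chi(G,\lambda)=\chi(H,\lambda)$ as polynomials. Two graphs are isomorphic if there is a bijection of their vertex sets preserving the numbers $a_{uv}$. The Cartesian product $G\times H$ has vertex set $V(G)\times V(H)$; $(g,h)$ and $(g',h')$ are adjacent if either $g=g'$ and $h$ is adjacent to $h'$ in $H$, or $h=h'$ and $g$ is adjacent to $g'$ in $G$, with edge multiplicities inherited from the corresponding factor. The product is commutative and associative up to isomorphism. For $m\ge 2$, $C_m$ is the cyclic graph on $m$ vertices, i.e. the graph on $\mathbb{Z}/m$ with one edge joining $j$ to $j+1$ for each $j\in\mathbb{Z}/m$; for $m\ge3$ it is the usual $m$-cycle, and $C_2$ consists of two vertices joined by two parallel edges. Its Laplacian spectrum is $\{4\sin^2(\pi j/m): j=0,1,\dots,m-1\}$ (with multiplicity). A discrete rectangular torus is a graph of the form $C_{m_1}\times C_{m_2}\times\cdots\times C_{m_p}$ with $p\ge 1$ and integers $m_i\ge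 2$ for $i=1,\dots,p$. *)

(* Defs.v *)
From mathcomp Require Import all_boot all_order all_algebra.
Set Implicit Arguments.
Unset Strict Implicit.
Unset Printing Implicit Defensive.
Import GRing.Theory.
Local Open Scope ring_scope.

(* Finite undirected loopless multigraphs, given by the number [mult u v] of
   edges between u and v. *)
Record multigraph := Multigraph {
  vertex :> finType;
  mult : vertex -> vertex -> nat;
  mult_sym : forall u v, mult u v = mult v u;
  mult_irr : forall u, mult u u = 0%N
}.

Definition isomorphic (G H : multigraph) : Prop :=
  exists2 f : G -> H, bijective f & forall u v, mult (f u) (f v) = mult u v.

Definition valency (G : multigraph) (v : G) : nat := (\sum_(u : G) mult u v)%N.

(* Matrices indexed by V(G) are indexed by 'I_#|G| through the enumeration
   [enum_val] of the vertices. *)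
Definition adjacency_mx (G : multigraph) : 'M[int]_#|G| :=
  \matrix_(i, j) (mult (enum_val i : G) (enum_val j : G))%:Z.

Definition valency_mx (G : multigraph) : 'M[int]_#|G| :=
  diag_mx (\row_i (valency (enum_val i : G))%:Z).

Definition laplacian_mx (G : multigraph) : 'M[int]_#|G| :=
  valency_mx G - adjacency_mx G.

(* This is det (L(G) - X I), which differs from [char_poly (laplacian_mx G)]
   by the sign (-1)^#|G|. *)
Definition laplacian_poly (G : multigraph) : {poly int} :=
  \det (map_mx polyC (laplacian_mx G) - 'X%:M).

Definition isospectral (G H : multigraph) : Prop :=
  laplacian_poly G = laplacian_poly H.

Section CartesianProduct.
Variables G H : multigraph.

(* The two summands are never both nonzero, since G and H are loopless. *)
Definition cart_mult (x y : G * H) : nat :=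
  ((x.1 == y.1) * mult x.2 y.2 + (x.2 == y.2) * mult x.1 y.1)%N.

Lemma cart_mult_sym x y : cart_mult x y = cart_mult y x.
Proof.
by rewrite /cart_mult (eq_sym x.1) (eq_sym x.2) (mult_sym x.1) (mult_sym x.2).
Qed.

Lemma cart_mult_irr x : cart_mult x x = 0%N.
Proof. by rewrite /cart_mult !mult_irr !muln0. Qed.

Definition cart_prod : multigraph := Multigraph cart_mult_sym cart_mult_irr.

End CartesianProduct.

Section Cycle.
Variable m : nat.

(* The edges are indexed by k : 'Z_m, edge k having the two ends k and k + 1;
   for m = 2 the edges 0 and 1 are parallel.  As 'Z_0 and 'Z_1 both stand for
   'Z_2, this is the m-cycle only for 1 < m. *)
Definition cycle_mult (u v : 'Z_m) : nat :=
  #|[set k : 'Z_m | [set k; k + 1] == [set u; v]]|.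

Lemma cycle_mult_sym u v : cycle_mult u v = cycle_mult v u.
Proof. by rewrite /cycle_mult (setUC [set u]). Qed.

Lemma cycle_mult_irr u : cycle_mult u u = 0%N.
Proof.
apply: eq_card0 => k; rewrite inE setUid; apply/negbTE/eqP.
move/(congr1 (fun A : {set 'Z_m} => #|A|)); rewrite cards1 cards2.
by rewrite -subr_eq0 opprD addrA subrr sub0r oppr_eq0 oner_eq0.
Qed.

Definition cycle_graph : multigraph := Multigraph cycle_mult_sym cycle_mult_irr.

End Cycle.

(* C_m x C_(m_2) x ... x C_(m_p), where s lists m_2, ..., m_p. *)
Fixpoint cycle_prod (m : nat) (s : seq nat) : multigraph :=
  if s is m' :: s' then cart_prod (cycle_graph m) (cycle_prod m' s')
  else cycle_graph m.

(* Graphs are taken up to isomorphism, so that every way of bracketing the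
   product is covered. *)
Definition rectangular_torus (T : multigraph) : Prop :=
  exists (m : nat) (s : seq nat),
    all (leq 2) (m :: s) /\ isomorphic T (cycle_prod m s).

(* Main.v *)
Require Import Defs.
From mathcomp Require Import all_boot all_order all_algebra.
From mathcomp Require Import perm algC ring zify.

Set Implicit Arguments.
Unset Strict Implicit.
Unset Printing Implicit Defensive.
Import GRing.Theory Num.Theory.
Local Open Scope ring_scope.

(** The spectrum of a graph determines the traces of the powers of its
    Laplacian L, hence, for a torus, the diagonal entries of L^n, which do not
    depend on the vertex.  These entries are best read through the series
    F(t) = sum_n (L^n)(v, v) t^n / n!, the diagonal entry of exp (t L): since
    the Laplacian of G x H is the sum of two commuting copies of the Laplacians
    of G and H, F is multiplicative on Cartesian products
    ([lap_pow_cart_prod], [lap_pow_cycle_prods]).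

    On C_m the operator L is - x^-1 (1 - x)^2, x being the shift, so that
    (L^n)(v, v) is, up to sign, the sum of the coefficients of (1 - x)^(2n)
    whose index is congruent to n modulo m ([lap_pow_cycle]).  A window of
    radius n < m meets this class only in n, which gives 'C(2n, n), as on the
    infinite path; at n = m the two extreme coefficients come in and
    contribute 2 (-1)^m more ([cycle_moment]).  So the series of C_m is that of
    the infinite path perturbed, first of all, in degree m: closed walks first
    notice the length of the cycle by going once around it, in either
    direction.

    The series of a torus therefore gives the number of its factors (coefficient
    of degree 1) and then, by induction on a, the number of factors of length a:
    once the factors shorter than a are known, the coefficient of degree a is
    known up to a nonzero multiple of this number ([cycle_egf_inj]).  Two
    isospectral tori have thus the same factors up to order, and the Cartesian
    product is commutative and associative ([cycle_prods_perm]).  The converse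
    is the invariance of the determinant under relabelling
    ([isomorphic_isospectral]). *)

(** * Isomorphisms of Cartesian products *)

Lemma isomorphic_refl G : isomorphic G G.
Proof. by exists id => //; exists id. Qed.

Lemma isomorphic_sym G H : isomorphic G H -> isomorphic H G.
Proof.
move=> [f [g fK gK] fM]; exists g; first by exists f.
by move=> u v; rewrite -fM !gK.
Qed.

Lemma isomorphic_trans G H K :
  isomorphic G H -> isomorphic H K -> isomorphic G K.
Proof.
move=> [f f_bij fM] [g g_bij gM]; exists (g \o f); first exact: bij_comp.
by move=> u v; rewrite /= gM fM.
Qed.

Lemma cart_prod_isor G H K :
  isomorphic H K -> isomorphic (cart_prod G H) (cart_prod G K).
Proof.
move=> [f f_bij fM]; have [g fK gK] := f_bij.
exists (fun x : cart_prod G H => (x.1, f x.2) : cart_prod G K).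
  by exists (fun x => (x.1, g x.2)) => -[x y] /=; rewrite ?fK ?gK.
by move=> u v; rewrite /= /cart_mult /= fM (inj_eq (bij_inj f_bij)).
Qed.

(** On iterated products bracketed to the right, this one exchange generates all
    reorderings of the factors. *)
Lemma cart_prod_isoCA G H K :
  isomorphic (cart_prod G (cart_prod H K)) (cart_prod H (cart_prod G K)).
Proof.
exists (fun x : cart_prod G (cart_prod H K) =>
          (x.2.1, (x.1, x.2.2)) : cart_prod H (cart_prod G K)).
  by exists (fun x => (x.2.1, (x.1, x.2.2))) => -[x [y z]].
move=> [x1 [x2 x3]] [y1 [y2 y3]]; rewrite /= /cart_mult /=.
rewrite /cart_mult /= !xpair_eqE !mulnDr !mulnA !mulnb (andbC (x2 == y2)).
rewrite (andbC (x2 == y2)).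
case: (x1 == y1); case: (x2 == y2); case: (x3 == y3);
  rewrite /= ?mul0n ?mul1n ?add0n ?addn0 //=.
exact: addnAC.
Qed.

(** The neutral element of the Cartesian product, so that lists of cycles may
    be empty in inductions. *)
Definition point_graph : multigraph :=
  @Multigraph unit (fun _ _ => 0%N) (fun _ _ => erefl) (fun _ => erefl).

Fixpoint cycle_prods (s : seq nat) : multigraph :=
  if s is m :: s' then cart_prod (cycle_graph m) (cycle_prods s')
  else point_graph.

Lemma cart_prod_point G : isomorphic G (cart_prod G point_graph).
Proof.
exists (fun x : G => (x, tt) : cart_prod G point_graph).
  by exists (fun x => x.1) => // -[x []].
by move=> u v; rewrite /= /cart_mult /= muln0 mul1n.
Qed.

Lemma cycle_prod_iso m s : isomorphic (cycle_prod m s) (cycle_prods (m :: s)).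
Proof.
elim: s m => [|m' s IHs] m; first exact: cart_prod_point.
exact: cart_prod_isor (IHs m').
Qed.

Lemma cycle_prods_perm s t :
  perm_eq s t -> isomorphic (cycle_prods s) (cycle_prods t).
Proof.
elim: s t => [|m s IHs] t.
  by rewrite perm_sym => /perm_nilP ->; apply: isomorphic_refl.
move=> st; have : m \in t by rewrite -(perm_mem st) mem_head.
move=> /path.splitPr t12; case: t12 st => t1 t2.
rewrite perm_sym -cat1s perm_catCA /= perm_cons perm_sym => /IHs st.
apply: isomorphic_trans (cart_prod_isor _ st) _.
elim: t1 {st} => [|n t1 IHt] /=; first exact: isomorphic_refl.
exact: isomorphic_trans (cart_prod_isoCA _ _ _) (cart_prod_isor _ IHt).
Qed.

(** * Invariance of the Laplacian polynomial *)

(** Two isomorphic graphs have Laplacian matrices of sizes that are only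
    propositionally equal, whence the two index types; a bijection between
    them makes the sizes equal and becomes a permutation. *)
Lemma det_reindex (R : comNzRingType) n p (A : 'M[R]_n) (B : 'M[R]_p)
    (f : 'I_n -> 'I_p) :
  bijective f -> (forall i j, A i j = B (f i) (f j)) -> \det A = \det B.
Proof.
move=> f_bij AB.
have np : n = p by rewrite -(card_ord n) -(card_ord p); apply: bij_eq_card f_bij.
case: p / np B f f_bij AB => B f f_bij AB.
pose s := perm (bij_inj f_bij).
have -> : A = row_perm s (col_perm s B).
  by apply/matrixP => i j; rewrite !mxE !permE AB.
by rewrite row_permE col_permE !det_mulmx !det_perm mulrCA
  -signr_addb perm.odd_permV addbb mulr1.
Qed.

Definition lap (G : multigraph) (u v : G) : int :=
  (valency u)%:Z *+ (u == v) - (mult u v)%:Z.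

Lemma laplacian_mxE G i j :
  laplacian_mx G i j = lap (enum_val i : G) (enum_val j).
Proof. by rewrite !mxE /lap (inj_eq enum_val_inj). Qed.

Lemma isomorphic_isospectral G H : isomorphic G H -> isospectral G H.
Proof.
move=> [f f_bij fM]; have [g fK gK] := f_bij.
pose h (i : 'I_#|G|) : 'I_#|H| := enum_rank (f (enum_val i)).
have h_bij : bijective h.
  exists (fun j => enum_rank (g (enum_val j))) => i;
  by rewrite /h enum_rankK ?fK ?gK enum_valK.
apply: (@det_reindex _ _ _ _ _ h) => // i j.
rewrite [LHS]mxE [RHS]mxE [X in X + _]mxE [X in _ = X + _]mxE.
rewrite !laplacian_mxE !enum_rankK /lap fM (inj_eq (bij_inj f_bij)).
rewrite /valency (reindex f) ?(eq_bigr _ (fun u _ => fM u _)) /=; last exact: onW_bij.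
congr (_ + _); rewrite !mxE (inj_eq (bij_inj h_bij)) //.
Qed.

(** * Moments of the spectrum *)

(** A real symmetric matrix is diagonalizable over the algebraic numbers, and
    similarity changes neither the characteristic polynomial nor the traces of
    powers. *)
Lemma charpoly_moments n (A : 'M[int]_n) : A^T = A ->
  exists2 d : seq algC, map_poly intr (char_poly A) = \prod_(x <- d) ('X - x%:P)
    & forall k, (\tr (A ^+ k))%:~R = \sum_(x <- d) x ^+ k.
Proof.
move=> A_sym; pose B := map_mx (intr : int -> algC) A.
have /orthomx_spectralP : B \is normalmx.
  apply: symmetric_normalmx.
    by rewrite is_hermitianmxE expr0 scale1r map_mx_id // map_trmx A_sym.
  by apply/mxOverP => i j; rewrite mxE realz.
set P := spectralmx B; set D := diag_mx _ => BPD.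
have P_unit : P \in unitmx := spectral_unit B.
exists [seq D i i | i <- enum 'I_n].
  rewrite map_char_poly -/B BPD big_map big_enum /=.
  rewrite -char_poly_trig ?diag_mx_is_trig // /char_poly /char_poly_mx.
  have -> : 'X%:M - map_mx polyC (invmx P *m D *m P) =
     map_mx polyC (invmx P) *m ('X%:M - map_mx polyC D) *m map_mx polyC P.
    rewrite mulmxBr mulmxBl -!map_mxM scalar_mxC -[in RHS](mulmxA 'X%:M).
    rewrite -map_mxM mulVmx //.
    by rewrite map_mx1 mulmx1.
  rewrite !det_mulmx mulrAC -det_mulmx -map_mxM mulVmx // map_mx1 det1.
  by rewrite mul1r.
have BX k : map_mx intr (A ^+ k) = invmx P *m D ^+ k *m P.
  elim: k => [|k IHk]; first by rewrite !expr0 mulmx1 mulVmx // map_mx1.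
  rewrite !exprS -!mulmxE map_mxM IHk -/B BPD -!mulmxA (mulmxA P) mulmxV //.
  by rewrite mul1mx.
move=> k; rewrite -[LHS]trace_map_mx BX mxtrace_mulC mulmxA mulmxV // mul1mx.
rewrite big_map big_enum /=; apply: eq_bigr => i _.
have -> : D ^+ k = diag_mx (\row_j D j j ^+ k).
  elim: k => [|k IHk]; first by rewrite expr0; apply/matrixP => a b;
    rewrite !mxE expr0.
  rewrite exprS IHk [LHS]mulmx_diag; congr diag_mx; apply/rowP => j.
  by rewrite !mxE exprS eqxx mulr1n.
by rewrite !mxE eqxx mulr1n.
Qed.

Lemma laplacian_mx_sym G : (laplacian_mx G)^T = laplacian_mx G.
Proof.
apply/matrixP => i j; rewrite mxE !laplacian_mxE /lap mult_sym eq_sym.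
by case: eqP => [->|].
Qed.

Lemma laplacian_polyE G :
  laplacian_poly G = (-1) ^+ #|G| * char_poly (laplacian_mx G).
Proof. by rewrite -detZ scaleN1r opprB. Qed.

(** The characteristic polynomial determines the eigenvalues, and these the
    traces of powers. *)
Lemma isospectral_moments G H : isospectral G H ->
  #|G| = #|H| /\
  forall k, \tr (laplacian_mx G ^+ k) = \tr (laplacian_mx H ^+ k).
Proof.
rewrite /isospectral !laplacian_polyE => GH.
have cGH : #|G| = #|H|.
  by move/(congr1 (size \o polyseq)): GH; rewrite /= !size_Msign !size_char_poly => -[].
split=> // k; move: GH.
have -> : (-1) ^+ #|H| = (-1) ^+ #|G| :> {poly int} by rewrite cGH.
move=> /(can_inj (signrMK _)) GH.
have [d dG trG] := charpoly_moments (laplacian_mx_sym G).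
have [e eH trH] := charpoly_moments (laplacian_mx_sym H).
apply: (@intr_inj algC); rewrite trG trH; apply: perm_big.
by apply: prod_XsubC_eq; rewrite -dG -eH GH.
Qed.

(** * Powers of the Laplacian *)

(** The entries of the powers of the Laplacian, indexed by the vertices
    themselves and not by their rank, so that the Cartesian product can be
    computed. *)
Fixpoint lap_pow (G : multigraph) (n : nat) (u v : G) : int :=
  if n is n'.+1 then \sum_(x : G) lap u x * lap_pow n' x v else (u == v)%:R.

Lemma laplacian_mx_powE G n i j :
  (laplacian_mx G ^+ n) i j = lap_pow n (enum_val i : G) (enum_val j).
Proof.
elim: n i j => [|n IHn] i j.
  by rewrite expr0 mxE /= (inj_eq enum_val_inj).
rewrite exprS -mulmxE mxE /= [RHS](reindex _ (onW_bij _ (@enum_val_bij G))).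
by apply: eq_bigr => k _; rewrite laplacian_mxE IHn.
Qed.

Lemma trace_laplacian_pow G n :
  \tr (laplacian_mx G ^+ n) = \sum_(v : G) lap_pow n v v.
Proof.
rewrite [RHS](reindex _ (onW_bij _ (@enum_val_bij G))).
by apply: eq_bigr => i _; rewrite laplacian_mx_powE.
Qed.

Lemma lap_cart_prod G H (x y : cart_prod G H) :
  lap x y = lap x.1 y.1 *+ (x.2 == y.2) + lap x.2 y.2 *+ (x.1 == y.1).
Proof.
case: x y => [g h] [g' h'] /=.
have -> : lap ((g, h) : cart_prod G H) (g', h') =
  (valency g + valency h)%:Z *+ ((g == g') && (h == h'))
  - (cart_mult (g, h) (g', h'))%:Z.
  rewrite /lap xpair_eqE /=; congr (_%:Z *+ _ - _).
  rewrite /valency -(pair_bigA _ (fun a b => cart_mult (a, b) (g, h))) /=.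
  rewrite /cart_mult /=; under eq_bigr do rewrite big_split /=.
  rewrite big_split /= addnC; congr addn.
    apply: eq_bigr => a _; rewrite (bigD1 h) //= eqxx mul1n big1 ?addn0 //.
    by move=> b /negPf ->.
  rewrite (bigD1 g) //= eqxx addnC big1 ?add0n //.
    by apply: eq_bigr => b _; rewrite mul1n.
  by move=> a /negPf ->; apply: big1.
rewrite /lap /cart_mult /=.
by case: (g == g'); case: (h == h'); rewrite /= ?mulr1n ?mulr0n; lia.
Qed.

(** The binomial formula for the sum of the commuting operators L_G x 1 and
    1 x L_H, entry by entry; Pascal's rule drives the induction. *)
Lemma lap_pow_cart_prod G H n (x y : cart_prod G H) :
  lap_pow n x y =
  \sum_(k < n.+1) lap_pow k x.1 y.1 * lap_pow (n - k) x.2 y.2 *+ 'C(n, k).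
Proof.
elim: n x y => [|n IHn] x y.
  by rewrite big_ord1 /= -natrM mulnb -pair_eqE.
(* L^(n+1) = L L^n, the first step being taken in G or in H. *)
have step : lap_pow n.+1 x y =
    (\sum_g lap x.1 g * lap_pow n ((g, x.2) : cart_prod G H) y) +
    \sum_h lap x.2 h * lap_pow n ((x.1, h) : cart_prod G H) y.
  case: x => g h /=.
  transitivity (\sum_a \sum_b lap ((g, h) : cart_prod G H) (a, b) *
      lap_pow n ((a, b) : cart_prod G H) y).
    by rewrite pair_bigA; apply: eq_bigr => -[].
  under [LHS]eq_bigr => a _.
    under eq_bigr => b _ do rewrite lap_cart_prod mulrDl /=.
    rewrite big_split /=.
    over.
  rewrite big_split /=; congr (_ + _).
    apply: eq_bigr => a _; rewrite (bigD1 h) //= eqxx mulr1n big1 ?addr0 //.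
    by move=> b /negPf hb; rewrite eq_sym hb mul0r.
  rewrite (bigD1 g) //= [X in _ + X]big1 ?addr0 => [|a /negPf ga].
    by apply: eq_bigr => b _; rewrite eqxx mulr1n.
  by apply: big1 => b _; rewrite eq_sym ga mul0r.
rewrite {}step; under eq_bigr do rewrite IHn mulr_sumr.
under [X in _ + X]eq_bigr do rewrite IHn mulr_sumr.
rewrite exchange_big [X in _ + X]exchange_big /=.
under eq_bigr => k _.
  under eq_bigr do rewrite mulrnAr mulrA.
  rewrite sumrMnl -mulr_suml.
  over.
under [X in _ + X]eq_bigr => k _.
  under eq_bigr do rewrite mulrnAr mulrCA.
  rewrite sumrMnl -mulr_sumr.
  over.
have -> : \sum_(k < n.+1) lap_pow k x.1 y.1 *
    (\sum_h lap x.2 h * lap_pow (n - k) h y.2) *+ 'C(n, k) =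
  \sum_(k < n.+2) lap_pow k x.1 y.1 * lap_pow (n.+1 - k) x.2 y.2 *+ 'C(n, k).
  rewrite [RHS]big_ord_recr /= bin_small // mulr0n addr0.
  by apply: eq_bigr => k _; rewrite subSn // -ltnS.
rewrite [X in _ + X]big_ord_recl [RHS]big_ord_recl /= !bin0 addrCA; congr (_ + _).
rewrite -big_split /=; apply: eq_bigr => k _.
by rewrite /bump /= !add1n subSS binS mulrnDr addrC.
Qed.

(** * Powers of the Laplacian of a cycle *)

Lemma addr1_neq m (u : 'Z_m) : (u + 1 == u) = false.
Proof. by rewrite -subr_eq0 addrC addKr oner_eq0. Qed.

(** For u <> v the edges between u and v are the edge u, if v = u + 1, and the
    edge v, if u = v + 1.  Both occur for m = 2, and then they are distinct. *)
Lemma cycle_multE m (u v : 'Z_m) :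
  cycle_mult u v = ((v == u + 1)%R + (u == v + 1)%R)%N.
Proof.
have [->|uv] := eqVneq u v.
  by rewrite cycle_mult_irr eq_sym addr1_neq.
have -> : cycle_mult u v =
    #|[set k | (k == u) && (v == u + 1)] :|: [set k | (k == v) && (u == v + 1)]|.
  apply: eq_card => k; rewrite !inE; apply/eqP/orP; last first.
    by case=> /andP[/eqP -> /eqP ->] //; rewrite setUC.
  move=> kuv; have : k + 1 \in [set u; v] by rewrite -kuv set22.
  have : k \in [set u; v] by rewrite -kuv set21.
  rewrite !inE => /orP[] /eqP -> /orP[] /eqP => [/eqP||<-|/eqP];
    rewrite ?addr1_neq ?eqxx //; [move=> <-| ]; rewrite ?eqxx; by [left|right].
rewrite cardsU [X in (_ - X)%N](_ : _ = 0%N) ?subn0; last first.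
  apply: eq_card0 => k; rewrite !inE; apply/negP.
  by case/andP => /andP[/eqP -> _] /andP[]; rewrite (negPf uv).
have card_and (w : 'Z_m) (b : bool) : #|[set k | (k == w) && b]| = b.
  case: b; last by apply: eq_card0 => k; rewrite inE andbF.
  by rewrite -[RHS](cards1 w); apply: eq_card => k; rewrite !inE andbT.
by rewrite !card_and.
Qed.

Lemma valency_cycle m (u : cycle_graph m) : valency u = 2%N.
Proof.
rewrite /valency /=; under eq_bigr do rewrite cycle_multE.
rewrite big_split /= (bigD1 (u - 1)) //= subrK eqxx big1 ?addn0; last first.
  by move=> v; rewrite eq_sym subr_eq => /negPf ->.
rewrite (bigD1 (u + 1)) //= eqxx big1 ?addn0 // => v /negPf uv.
by rewrite uv.
Qed.

Lemma sum_lap_cycle m (F : 'Z_m -> int) (u : cycle_graph m) :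
  \sum_(x : cycle_graph m) lap u x * F x = F u *+ 2 - F (u + 1) - F (u - 1).
Proof.
have delta (w : 'Z_m) : \sum_(x : 'Z_m) (x == w)%:R * F x = F w.
  rewrite (bigD1 w) //= eqxx mul1r big1 ?addr0 // => x /negPf ->.
  by rewrite mul0r.
rewrite -(delta u) -(delta (u + 1)) -(delta (u - 1)) -sumrMnl -!sumrB.
apply: eq_bigr => x _; rewrite /lap valency_cycle /= cycle_multE.
rewrite -(subr_eq u x 1) (eq_sym u x) (eq_sym (u - 1)).
by case: (x == u); case: (x == u + 1); case: (x == u - 1); rewrite /=; ring.
Qed.

(** The sum of the coefficients of (1 - x)^N at the exponents congruent to d
    modulo m, that is, the coefficient of x^d in the image of (1 - x)^N in the
    group ring of the cyclic group. *)
Definition alt_bin_mod m (N : nat) (d : 'Z_m) : int :=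
  \sum_(k < N.+1) (-1) ^+ k * 'C(N, k)%:R * (k%:R == d)%:R.

Lemma alt_bin_modS m N (d : 'Z_m) :
  alt_bin_mod N.+1 d = alt_bin_mod N d - alt_bin_mod N (d - 1).
Proof.
rewrite /alt_bin_mod.
have -> : \sum_(k < N.+1) (-1) ^+ k * 'C(N, k)%:R * (k%:R == d)%:R =
  \sum_(k < N.+2) (-1) ^+ k * 'C(N, k)%:R * (k%:R == d)%:R :> int.
  by rewrite [RHS]big_ord_recr /= bin_small // mulr0 mul0r addr0.
rewrite big_ord_recl [X in _ = X - _]big_ord_recl /= !bin0 -addrA; congr (_ + _).
rewrite -sumrB; apply: eq_bigr => k _.
rewrite /bump /= !add1n binS natrD exprS [_ == d - 1]eq_sym subr_eq.
by rewrite (eq_sym d) -natr1; ring.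
Qed.

(** In the group ring, L is 2 - x - x^-1 = - x^-1 (1 - x)^2. *)
Lemma lap_pow_cycle m n (u v : cycle_graph m) :
  lap_pow n u v = (-1) ^+ n * alt_bin_mod n.*2 ((v : 'Z_m) - u + n%:R).
Proof.
elim: n u v => [|n IHn] u v.
  rewrite /alt_bin_mod big_ord1 /= addr0 expr0 !mul1r (eq_sym 0) subr_eq0.
  by rewrite eq_sym.
rewrite /= (@sum_lap_cycle m (fun x => @lap_pow (cycle_graph m) n x v)) !IHn.
rewrite doubleS !alt_bin_modS.
rewrite -natr1 exprS.
have -> : (v : 'Z_m) - u + (n%:R + 1) - 1 = v - u + n%:R by ring.
have -> : (v : 'Z_m) - (u + 1) + n%:R = v - u + n%:R - 1 by ring.
have -> : (v : 'Z_m) - (u - 1) + n%:R = v - u + (n%:R + 1) by ring.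
ring.
Qed.

(** Among the exponents k between 0 and 2n, those congruent to n modulo m are
    k = n alone if n < m, and k = 0, n, 2n if n = m. *)
Lemma cycle_moment m n (u : cycle_graph m) : (1 < m)%N -> (n <= m)%N ->
  lap_pow n u u = ('C(n.*2, n))%:R + ((-1) ^+ n *+ 2) *+ (n == m).
Proof.
move=> m_gt1 le_nm; rewrite lap_pow_cycle subrr add0r /alt_bin_mod.
have eqmod k : (k%:R == n%:R :> 'Z_m) = (k == n %[mod m]).
  by rewrite -val_eqE /= !val_Zp_nat.
have n_lt : (n < n.*2.+1)%N by lia.
rewrite (bigD1 (Ordinal n_lt)) //= eqxx mulr1 mulrDr signrMK.
congr (_ + _).
(* Such a k is at distance at most n <= m from n, so at distance 0 or m. *)
have far k : (k <= n.*2)%N -> k != n ->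
    (k%:R == n%:R :> 'Z_m) = (n == m) && ((k == 0%N) || (k == n.*2)).
  move=> k_le k_ne; rewrite eqmod.
  have [le_kn|lt_nk] := leqP k n.
    rewrite eq_sym eqn_mod_dvd //; apply/idP/idP => [/dvdn_leq|]; first lia.
    case/andP=> /eqP -> /orP[/eqP ->|/eqP ?]; last by lia.
    by rewrite subn0.
  rewrite eqn_mod_dvd ?(ltnW lt_nk) //.
  apply/idP/idP => [/dvdn_leq|]; first lia.
  case/andP=> /eqP -> /orP[/eqP ?|/eqP ->]; first by lia.
  by rewrite -addnn addnK.
have [nm|nm] := eqVneq n m; last first.
  rewrite big1 ?mulr0 // => k k_ne; rewrite far ?(negPf nm) ?mulr0 //.
  by rewrite -ltnS.
have k0 : (0 < n.*2.+1)%N by [].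
have k2 : (n.*2 < n.*2.+1)%N by [].
rewrite (bigD1 (Ordinal k0)) /=; last by rewrite -val_eqE /=; lia.
rewrite (bigD1 (Ordinal k2)) /=; last by rewrite -!val_eqE /=; lia.
rewrite !far ?nm ?eqxx ?orbT //=; try lia.
rewrite big1 => [|k /andP[/andP[kn k_0] k_2]].
  by rewrite nm eqxx bin0 binn expr0 -muln2 mulnC exprM sqrrN !expr1n /=; ring.
rewrite far //; last by rewrite -ltnS.
by move: k_0 k_2; rewrite -!val_eqE /= => /negPf -> /negPf ->; rewrite andbF mulr0.
Qed.

(** * Recovering the factors *)

(** The series of exp (t L) at a vertex of the cycle, cut to degrees below N so as
    to be a polynomial.  The vertex 0 stands for any other, by rotation. *)
Definition cycle_egf (N m : nat) : {poly rat} :=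
  \poly_(n < N) ((@lap_pow (cycle_graph m) n 0 0)%:~R / n`!%:R).

(** Dividing by factorials turns the binomial convolution of
    [lap_pow_cart_prod] into the product of series.  The vertex v is arbitrary:
    on a cycle, hence on a torus, the diagonal entries are all equal. *)
Lemma lap_pow_cycle_prods N s (v : cycle_prods s) n : (n < N)%N ->
  (lap_pow n v v)%:~R / n`!%:R = (\prod_(m <- s) cycle_egf N m)`_n.
Proof.
elim: s v n => [|m s IHs] v n ltnN.
  rewrite big_nil coef1; case: n ltnN => [|n] _; first by rewrite divr1; case: v.
  rewrite /= big1 ?mul0r // => x _.
  by rewrite /lap /valency /= big1 // mul0rn subr0 mul0r.
rewrite big_cons coefM lap_pow_cart_prod rmorph_sum /= mulr_suml.
apply: eq_bigr => k _; have lekn : (k <= n)%N by rewrite -ltnS.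
rewrite coef_poly (leq_ltn_trans lekn ltnN) -(IHs v.2); last first.
  exact: leq_ltn_trans (leq_subr _ _) ltnN.
rewrite !lap_pow_cycle !subrr -(bin_fact lekn) rmorphMn rmorphM !natrM.
rewrite -[_ *+ 'C(n, k)]mulr_natr; field.
by rewrite !pnatr_eq0 -!lt0n !fact_gt0 bin_gt0 lekn.
Qed.

(** To first order, perturbations of degree a add up, as the unperturbed
    factors have constant term 1. *)
Lemma prod_addXn (R : comNzRingType) (I : eqType) (a : nat) (s : seq I)
    (Q : I -> {poly R}) (c : I -> R) : (0 < a)%N ->
  (forall i, i \in s -> (Q i)`_0 = 1) ->
  (\prod_(i <- s) (Q i + c i *: 'X^a))`_a =
  (\prod_(i <- s) Q i)`_a + \sum_(i <- s) c i.
Proof.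
move=> a_gt0 Q1.
suff [S -> S0] : exists2 S : {poly R},
    \prod_(i <- s) (Q i + c i *: 'X^a) = \prod_(i <- s) Q i + S * 'X^a
    & S`_0 = \sum_(i <- s) c i.
  by rewrite coefD coefMXn ltnn subnn S0.
have prod1 t : {subset t <= s} -> (\prod_(i <- t) Q i)`_0 = 1.
  elim: t => [|i t IHt] sub; first by rewrite big_nil coef1.
  rewrite big_cons coef0M IHt ?Q1 ?mulr1 ?sub ?mem_head // => j jt.
  by rewrite sub // inE jt orbT.
have: {subset s <= s} by [].
elim: {-2}s => [|i t IHt] sub.
  by exists 0; rewrite ?coef0 ?big_nil // mul0r addr0.
have sub_t : {subset t <= s} by move=> j jt; rewrite sub // inE jt orbT.
have [S St S0] := IHt sub_t.
exists (Q i * S + c i *: \prod_(j <- t) Q j + c i *: (S * 'X^a)).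
  rewrite !big_cons St -!mul_polyC; ring.
rewrite !coefD !coefZ coef0M coefMXn a_gt0 (Q1 i) ?sub ?mem_head //.
by rewrite prod1 // S0 big_cons; ring.
Qed.

(** Up to degree m, the series of C_m is that of the infinite path, except for
    the two closed walks once around the cycle, which appear in degree m. *)
Lemma cycle_egfE a m : (1 < m)%N -> (a <= m)%N ->
  cycle_egf a.+1 m = \poly_(n < a.+1) ('C(n.*2, n)%:R / n`!%:R)
     + (if m == a then (-1) ^+ a *+ 2 / a`!%:R else 0) *: 'X^a.
Proof.
move=> m_gt1 le_am; apply/polyP => n.
rewrite coefD coefZ coefXn !coef_poly ltnS.
have [le_na|lt_an] := leqP n a; last first.
  by rewrite add0r (gtn_eqF lt_an) mulr0.
rewrite cycle_moment // ?(leq_trans le_na) // rmorphD /= rmorph_nat mulrDl.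
congr (_ + _).
have [->|ne_na] := eqVneq n a.
  rewrite mulr1 (eq_sym m); case: eqP => _; last by rewrite mulr0n rmorph0 mul0r.
  by rewrite mulr1n rmorphMn rmorphXn rmorphN1.
rewrite mulr0 (_ : n == m = false) ?mulr0n ?rmorph0 ?mul0r //.
by apply: ltn_eqF; apply: leq_trans le_am; rewrite ltn_neqAle ne_na.
Qed.

(** Compare the coefficients of degree a, by induction on a.  Up to this degree
    the factors longer than a contribute a series that does not depend on their
    length, and the factors shorter than a are the same on both sides; the
    number of factors of length a is all that remains. *)
Lemma cycle_egf_inj s t : all (leq 2) s -> all (leq 2) t ->
  (forall N n, (n < N)%N ->
    (\prod_(m <- s) cycle_egf N m)`_n = (\prod_(m <- t) cycle_egf N m)`_n) ->
  perm_eq s t.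
Proof.
move=> s_ge2 t_ge2 st.
have count0 r : all (leq 2) r -> count_mem 0%N r = 0%N.
  by move=> /allP r_ge2; apply/count_memPn; apply/negP => /r_ge2.
pose e a : rat := (-1) ^+ a *+ 2 / a`!%:R.
have e_neq0 a : e a != 0.
  by rewrite mulf_neq0 ?invr_eq0 ?pnatr_eq0 -?lt0n ?fact_gt0 //
    mulrn_eq0 signr_eq0.
pose lim a : {poly rat} := \poly_(n < a.+1) ('C(n.*2, n)%:R / n`!%:R).
have egf_at0 a m : (cycle_egf a.+1 m)`_0 = 1 by rewrite coef_poly /= divr1.
have lim_at0 a : (lim a)`_0 = 1 by rewrite coef_poly /= bin0 divr1.
(* Every factor contributes 2, its valency, to the coefficient of degree 1. *)
have eq_size : size s = size t.
  have coef1 r : all (leq 2) r ->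
      (\prod_(m <- r) cycle_egf 2 m)`_1 = 2 *+ size r.
    move=> /allP r_ge2.
    have -> : \prod_(m <- r) cycle_egf 2 m = \prod_(m <- r) (1 + 2 *: 'X^1).
      apply: eq_big_seq => m /r_ge2 m_gt1.
      rewrite cycle_egfE ?(ltnW m_gt1) // gtn_eqF // scale0r addr0.
      apply/polyP => n; rewrite coef_poly coefD coefZ coef1 coefXn.
      by case: n => [|[|n]]; rewrite ?bin0 ?bin1 ?divr1 ?mulr0 ?addr0 ?mulr1 ?add0r.
    rewrite prod_addXn // => [|m _]; last by rewrite coef1.
    rewrite big1 // coef1 add0r big_const_seq iter_addr addr0.
    by rewrite (eq_count (a2 := predT)) // count_predT.
  have := st 2%N 1%N isT; rewrite !coef1 // => /mulrIn; apply.
  by rewrite pnatr_eq0.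
(* The series of C_m with its term of degree a replaced, for m = a, by that of
   the infinite path; for m >= a it does not depend on m. *)
pose Q a m := if (m < a)%N then cycle_egf a.+1 m else lim a.
have coef_a a r : all (leq 2) r -> (0 < a)%N ->
    (\prod_(m <- r) cycle_egf a.+1 m)`_a =
    (\prod_(m <- r) Q a m)`_a + e a *+ count_mem a r.
  move=> /allP r_ge2 a_gt0.
  have -> : e a *+ count_mem a r = \sum_(m <- r) (if m == a then e a else 0).
    by rewrite -big_mkcond big_const_seq iter_addr addr0.
  rewrite -prod_addXn // => [|m _]; last by rewrite /Q; case: ifP.
  congr (nth 0 (polyseq _) _); apply: eq_big_seq => m /r_ge2 m_gt1; rewrite /Q.
  case: ltnP => [lt_ma|le_am]; last by rewrite cycle_egfE.
  by rewrite ltn_eqF // scale0r addr0.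
have prodQ a r : \prod_(m <- r) Q a m =
    (\prod_(m <- [seq m <- r | (m < a)%N]) cycle_egf a.+1 m) *
    lim a ^+ (size r - size [seq m <- r | (m < a)%N]).
  rewrite (bigID (fun m => m < a)%N) /= big_filter; congr (_ * _).
    by apply: eq_bigr => m lt_ma; rewrite /Q lt_ma.
  rewrite size_filter -(count_predC (fun m => m < a)%N r) addKn.
  rewrite (eq_bigr (fun=> lim a)); first by rewrite big_const_seq iter_mulr mulr1.
  by move=> m /negPf; rewrite /Q => ->.
have eq_count a : count_mem a s = count_mem a t.
  have [n] := ubnP a; elim: n a => // n IHn a; rewrite ltnS => le_an.
  have [a0|a_gt0] := posnP a; first by rewrite a0 !count0.
  have low : perm_eq [seq m <- s | (m < a)%N] [seq m <- t | (m < a)%N].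
    apply/allP => m _ /=; apply/eqP; rewrite !count_filter.
    have [lt_ma|le_am] := ltnP m a.
      rewrite !(@eq_count _ _ (pred1 m)) ?IHn ?(leq_trans lt_ma) // => k /=;
      by case: eqP => // ->.
    rewrite !(@eq_count _ _ pred0) ?count_pred0 // => k /=;
    by case: eqP => // ->; rewrite ltnNge le_am.
  have := st a.+1 a (leqnn _); rewrite !coef_a // !prodQ eq_size.
  rewrite (perm_size low) (perm_big _ low) => /addrI /mulrIn; apply.
  exact: e_neq0.
by apply/allP => a _; apply/eqP/eq_count.
Qed.

Lemma card_cycle_prods_gt0 s : (0 < #|cycle_prods s|)%N.
Proof.
elim: s => [|m s IHs]; first by rewrite card_unit.
by rewrite card_prod muln_gt0 card_ord.
Qed.

Lemma isospectral_cycle_prods s t : all (leq 2) s -> all (leq 2) t ->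
  isospectral (cycle_prods s) (cycle_prods t) -> perm_eq s t.
Proof.
move=> s_ge2 t_ge2 /isospectral_moments[st_card st_trace].
apply: cycle_egf_inj => // N n ltnN.
have trace_coef r : (\tr (laplacian_mx (cycle_prods r) ^+ n))%:~R =
    (\prod_(m <- r) cycle_egf N m)`_n * n`!%:R *+ #|cycle_prods r|.
  rewrite trace_laplacian_pow rmorph_sum -sumr_const /=.
  apply: eq_bigr => v _; rewrite -(lap_pow_cycle_prods v) // divfK //.
  by rewrite pnatr_eq0 -lt0n fact_gt0.
have /eqP := congr1 (intr : int -> rat) (st_trace n).
rewrite !trace_coef st_card -subr_eq0 -mulrnBl mulrn_eq0.
rewrite -[_ == 0%N]negbK -lt0n card_cycle_prods_gt0 /= -mulrBl mulf_eq0.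
by rewrite pnatr_eq0 -[_`! == 0%N]negbK -lt0n fact_gt0 orbF subr_eq0 => /eqP.
Qed.

Theorem theorem2 (T T' : multigraph) (hT : rectangular_torus T)
    (hT' : rectangular_torus T') :
  isospectral T T' <-> isomorphic T T'.
Proof.
split=> [specTT'|]; last exact: isomorphic_isospectral.
have [m [s [s_ge2 Ts]]] := hT; have [n [t [t_ge2 T't]]] := hT'.
have Ts' := isomorphic_trans Ts (cycle_prod_iso m s).
have Tt' := isomorphic_trans T't (cycle_prod_iso n t).
have spec_s := isomorphic_isospectral Ts'.
have spec_t := isomorphic_isospectral Tt'.
have st : isospectral (cycle_prods (m :: s)) (cycle_prods (n :: t)).
  by rewrite /isospectral -spec_s specTT'.
have iso_st := cycle_prods_perm (isospectral_cycle_prods s_ge2 t_ge2 st).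
exact: isomorphic_trans Ts' (isomorphic_trans iso_st (isomorphic_sym Tt')).
Qed.
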